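(* Let $n\ge 1$ and let $H$ be a Lie group with Levi decomposition $H=L\ltimes\mathbb{R}^n$, where $L$ is a semisimple Lie group with no compact factors and with Kazhdan's property $(T)$, and the linear representation of $L$ on $\mathbb{R}^n$ defining the semidirect product has no nonzero invariant vectors. Then neither $H$ nor any lattice in $H$ has property $F\otimes H$.
   Context: ''Semisimple Lie group'' means a connected semisimple (real) Lie group with finite center, assumed algebraic and simply connected as an algebraic group (every cover which is algebraic is isomorphic to it). Cohomology of topological groups is continuous cohomology. Property $F\otimes H$: a topological group $D$ has property $F\otimes H$ if for every finite dimensional vector space $F$ over $\mathbb{R}$ or $\mathbb{C}$, every continuous homomorphism $\pi_1:D\to GL(F)$, every Hilbert space $\mathcal{H}$ and every continuous unitary representation $\pi_2:D\to\mathcal{U}(\mathcal{H})$, the first continuous cohomology group $H^1(D,\pi_1\otimes\pi_2,F\otimes\mathcal{H})$ vanishes. (The letter $H$ in the name of the property is unrelated to the group $H$.) *)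

(* Defs.v *)
From HB Require Import structures.
From mathcomp Require Import all_boot all_order all_algebra sesquilinear.
From mathcomp Require Import all_classical all_reals all_analysis.
From mathcomp Require Import complex generic_quotient.
From mathcomp Require mpoly.

Set Implicit Arguments.
Unset Strict Implicit.
Unset Printing Implicit Defensive.

Import Order.TTheory GRing.Theory Num.Theory.
Import numFieldNormedType.Exports.

Local Open Scope classical_set_scope.
Local Open Scope ring_scope.

HB.mixin Record isTopGroup G & Topological G & Group G := {
  mulg_continuous : continuous (fun xy : G * G => (xy.1 * xy.2)%g);
  invg_continuous : continuous (fun x : G => (x^-1)%g)
}.

#[short(type="topGroupType")]
HB.structure Definition TopGroup :=
  {G of Topological G & Group G & isTopGroup G}.

Definition topgroup_iso (G H : topGroupType) : Prop :=
  exists (f : G -> H) (f' : H -> G),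
    [/\ forall x y, f (x * y)%g = (f x * f y)%g,
        cancel f f', cancel f' f, continuous f & continuous f'].

Definition covering_hom (G H : topGroupType) (p : G -> H) : Prop :=
  [/\ forall x y, p (x * y)%g = (p x * p y)%g,
      continuous p,
      forall U, open U -> open (p @` U),
      range p = setT
    & exists2 U, open U & U `&` [set x | p x = 1%g] = [set 1%g]].

Definition group_set (G : groupType) (S : set G) : Prop :=
  [/\ S 1%g, forall x y, S x -> S y -> S (x * y)%g
    & forall x, S x -> S (x^-1)%g].

Definition normal_set (G : groupType) (S : set G) : Prop :=
  forall x y, S x -> S (x ^ y)%g.

Record subgroup (G : groupType) :=
  Subgroup { subgroup_set :> set G; subgroupP : group_set subgroup_set }.

Definition subgroup_type (G : groupType) (S : subgroup G) : Type :=
  set_type (subgroup_set S).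

Section SubgroupGroup.
Context {G : groupType} (S : subgroup G).
Local Notation T := (subgroup_type S).

HB.instance Definition _ := Choice.on T.

Definition subg_one : T := SigSub (mem_set (let: And3 h _ _ := subgroupP S in h)).
Definition subg_mul (x y : T) : T :=
  SigSub (mem_set (let: And3 _ h _ := subgroupP S in
    h _ _ (set_mem (valP x)) (set_mem (valP y)))).
Definition subg_inv (x : T) : T :=
  SigSub (mem_set (let: And3 _ _ h := subgroupP S in
    h _ (set_mem (valP x)))).

Fact subg_mulA : associative subg_mul.
Proof. by move=> x y z; apply: val_inj; rewrite /= mulgA. Qed.
Fact subg_mul1 : left_id subg_one subg_mul.
Proof. by move=> x; apply: val_inj; rewrite /= mul1g. Qed.
Fact subg_mulr1 : right_id subg_one subg_mul.
Proof. by move=> x; apply: val_inj; rewrite /= mulg1. Qed.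
Fact subg_mulV : left_inverse subg_one subg_inv subg_mul.
Proof. by move=> x; apply: val_inj; rewrite /= mulVg. Qed.
Fact subg_mulrV : right_inverse subg_one subg_inv subg_mul.
Proof. by move=> x; apply: val_inj; rewrite /= mulgV. Qed.

HB.instance Definition _ := isGroup.Build T
  subg_mulA subg_mul1 subg_mulr1 subg_mulV subg_mulrV.
End SubgroupGroup.

Section SubgroupTopGroup.
Context {G : topGroupType} (S : subgroup G).
Local Notation T := (subgroup_type S).

HB.instance Definition _ := Topological.copy T (set_type (subgroup_set S)).

Fact subg_continuous (X : topologicalType) (f : X -> T) :
  continuous (fun x => val (f x) : G) -> continuous f.
Proof.
move=> /continuousP cf; apply/continuousP => _ [B oB <-].
exact: cf.
Qed.

Fact subg_val_continuous : continuous (val : T -> G).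
Proof. exact: (@initial_continuous (set_type (subgroup_set S)) G set_val). Qed.

Fact subg_mul_continuous : continuous (fun xy : T * T => (xy.1 * xy.2)%g).
Proof.
apply: subg_continuous => -[x y] /=.
apply: (@continuous_comp _ _ _ (fun xy : T * T => (val xy.1, val xy.2))
  (fun xy : G * G => (xy.1 * xy.2)%g)); last exact: mulg_continuous.
apply: cvg_pair => /=.
  by apply: (@cvg_comp _ _ _ fst val _ (nbhs x));
    [exact: cvg_fst|exact: subg_val_continuous].
by apply: (@cvg_comp _ _ _ snd val _ (nbhs y));
  [exact: cvg_snd|exact: subg_val_continuous].
Qed.

Fact subg_inv_continuous : continuous (fun x : T => (x^-1)%g).
Proof.
apply: subg_continuous => x /=.
apply: (@continuous_comp _ _ _ (val : T -> G) (fun x : G => (x^-1)%g)).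
  exact: subg_val_continuous.
exact: invg_continuous.
Qed.

HB.instance Definition _ :=
  isTopGroup.Build T subg_mul_continuous subg_inv_continuous.
End SubgroupTopGroup.

(* A continuous homomorphism D -> GL_d(K); invertibility of the values follows
   from the homomorphism laws. *)
Record fin_rep (K : numFieldType) (D : topGroupType) (d : nat) := FinRep {
  fin_rep_fun :> D -> 'M[K]_d;
  fin_rep1 : fin_rep_fun 1%g = 1%:M;
  fin_repM : forall g h, fin_rep_fun (g * h)%g = fin_rep_fun g *m fin_rep_fun h;
  fin_rep_continuous : continuous fin_rep_fun
}.

HB.mixin Record hasInnerProduct (C : numClosedFieldType) V
    & CompleteNormedModule C V := {
  inner : {dot V for (@Num.conj C)};
  inner_normE : forall v : V, `|v| ^+ 2 = inner v v
}.

#[short(type="hilbertType")]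
HB.structure Definition Hilbert (C : numClosedFieldType) :=
  {V of CompleteNormedModule C V & hasInnerProduct C V}.

(* Strongly continuous; each [unitary_fun g] is onto since [unitary_fun g^-1]
   is its inverse. *)
Record unitary_rep (C : numClosedFieldType) (D : topGroupType)
    (V : hilbertType C) := UnitaryRep {
  unitary_fun :> D -> V -> V;
  unitary_linear : forall g, linear (unitary_fun g);
  unitary1 : forall v, unitary_fun 1%g v = v;
  unitaryM : forall g h v,
    unitary_fun (g * h)%g v = unitary_fun g (unitary_fun h v);
  unitary_inner : forall g u v,
    inner (unitary_fun g u) (unitary_fun g v) = inner u v :> C;
  unitary_continuous : forall v, continuous (fun g => unitary_fun g v)
}.

HB.instance Definition _ (V : PreTopologicalZmodule.type) m n :=
  Topological.on 'M[V]_(m, n).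

Section ContinuousCohomology.
Context (D : topGroupType) (A : PreTopologicalZmodule.type) (act : D -> A -> A).

Definition Z1 : set (D -> A) :=
  [set b | continuous b /\ forall g h, b (g * h)%g = b g + act g (b h)].
Definition B1 : set (D -> A) :=
  [set b | exists v, forall g, b g = act g v - v].
Definition H1_vanishes : Prop := Z1 `<=` B1.
End ContinuousCohomology.

(* K^d (x) V is the space 'cV[V]_d of d-tuples of vectors of V, the elementary
   tensor x (x) v being the tuple of the [x i *: v].  The scalars of F = K^d act
   on V through [emb]: for K = R this is the tensor product over R of a real F
   with the complex space V. *)
Definition tensor_act (K : numFieldType) (C : numClosedFieldType)
    (emb : K -> C) (D : topGroupType) (d : nat) (V : hilbertType C)
    (pi1 : fin_rep K D d) (pi2 : unitary_rep D V)
    (g : D) (w : 'cV[V]_d) : 'cV[V]_d :=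
  \col_i \sum_j emb (pi1 g i j) *: pi2 g (w j 0).

Definition FH_over (K : numFieldType) (C : numClosedFieldType)
    (emb : K -> C) (D : topGroupType) : Prop :=
  forall (d : nat) (pi1 : fin_rep K D d)
         (V : hilbertType C) (pi2 : unitary_rep D V),
    H1_vanishes (tensor_act emb pi1 pi2).

Definition property_FH (R : realType) (D : topGroupType) : Prop :=
  FH_over (real_complex R) D /\ FH_over (@id R[i]) D.

Definition kazhdan_T (R : realType) (D : topGroupType) : Prop :=
  exists (Q : set D) (e : R), [/\ compact Q, 0 < e &
    forall (V : hilbertType R[i]) (pi : unitary_rep D V),
      (exists2 v : V, v != 0 &
         forall g, Q g -> `|pi g v - v| < real_complex R e * `|v|) ->
      exists2 v : V, v != 0 & forall g, pi g v = v].

(* The real points of an algebraic subgroup of GL_m defined over R. *)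
Definition zariski_closed_group (R : realType) (m : nat) (G : set 'M[R]_m)
    : Prop :=
  [/\ G 1%:M, forall A B, G A -> G B -> G (A *m B),
      forall A, G A -> G (invmx A)
    & exists P : set (mpoly.mpoly (m * m) R),
        G = [set A | A \in unitmx /\
               forall p, P p -> mpoly.meval (fun k => mxvec A 0 k) p = 0]].

(* L is isomorphic, as a topological group, to the identity component of the
   group of real points of a linear algebraic group. *)
Definition algebraic (R : realType) (L : topGroupType) : Prop :=
  exists (m : nat) (G : set 'M[R]_m) (f : L -> 'M[R]_m),
    [/\ zariski_closed_group G,
        forall x y, f (x * y)%g = f x *m f y,
        injective f,
        forall U, open U <-> exists2 V, open V & f @^-1` V = U
      & range f = connected_component G 1%:M].

Definition alg_simply_connected (R : realType) (L : topGroupType) : Prop :=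
  forall (L' : topGroupType) (p : L' -> L),
    connected [set: L'] -> algebraic R L' -> covering_hom p ->
    topgroup_iso L' L.

Fixpoint derived_set (G : groupType) (S : set G) (k : nat) : set G :=
  if k is k'.+1 then
    smallest (@group_set G)
      [set z | exists x y,
         [/\ derived_set S k' x, derived_set S k' y & z = [~ x, y]%g]]
  else S.

Definition solvable_set (G : groupType) (S : set G) : Prop :=
  exists k, derived_set S k = [set 1%g].

Definition trivial_radical (L : topGroupType) : Prop :=
  forall N : set L, group_set N -> normal_set N -> connected N ->
    solvable_set N -> N = [set 1%g].

Definition semisimple_lie_group (R : realType) (L : topGroupType) : Prop :=
  [/\ connected [set: L], trivial_radical L,
      finite_set [set z : L | forall x, (z * x = x * z)%g],
      algebraic R L & alg_simply_connected R L].

Definition no_compact_factors (L : topGroupType) : Prop :=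
  forall N : set L, group_set N -> normal_set N -> connected N ->
    compact N -> N = [set 1%g].

Definition semidirect (R : realType) (L : topGroupType) (n : nat)
  (rho : fin_rep R L n) : Type := (L * 'cV[R]_n)%type.

Section Semidirect.
Context (R : realType) (L : topGroupType) (n : nat) (rho : fin_rep R L n).
Local Notation H := (semidirect rho).

HB.instance Definition _ := Topological.copy H (L * 'cV[R]_n)%type.

Definition sd_one : H := (1%g, 0).
Definition sd_mul (x y : H) : H := ((x.1 * y.1)%g, x.2 + rho x.1 *m y.2).
Definition sd_inv (x : H) : H := ((x.1^-1)%g, - (rho (x.1^-1)%g *m x.2)).

Fact sd_mulA : associative sd_mul.
Proof.
by move=> x y z; rewrite /sd_mul /= mulgA fin_repM mulmxDr mulmxA addrA.
Qed.
Fact sd_mul1 : left_id sd_one sd_mul.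
Proof. by case=> x v; rewrite /sd_mul /= mul1g fin_rep1 mul1mx add0r. Qed.
Fact sd_mulr1 : right_id sd_one sd_mul.
Proof. by case=> x v; rewrite /sd_mul /= mulg1 mulmx0 addr0. Qed.
Fact sd_mulV : left_inverse sd_one sd_inv sd_mul.
Proof. by move=> x; rewrite /sd_mul /= mulVg addNr. Qed.
Fact sd_mulrV : right_inverse sd_one sd_inv sd_mul.
Proof.
by move=> x; rewrite /sd_mul /= mulmxN mulmxA -fin_repM mulgV fin_rep1 mul1mx subrr.
Qed.

HB.instance Definition _ := isGroup.Build H
  sd_mulA sd_mul1 sd_mulr1 sd_mulV sd_mulrV.

Fact cV_continuous (X : topologicalType) (f : X -> 'cV[R]_n) :
  (forall i, continuous (fun x => f x i 0)) -> continuous f.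
Proof.
move=> cf x A [P Pn sA]; rewrite nbhs_simpl /=.
have h : \forall y \near x, forall i, P i 0 (f y i 0).
  by apply: filter_forall => i; apply: cf; exact: Pn.
by apply: filterS h => y hy; apply: sA => i j; rewrite (ord1 j); exact: hy.
Qed.

Fact entry_continuous p q (i : 'I_p) (j : 'I_q) :
  continuous (fun A : 'M[R]_(p, q) => A i j).
Proof.
move=> A B nB; rewrite nbhs_simpl /=.
exists (fun i' j' => if (i' == i) && (j' == j) then B else setT) => [i' j'|A' ].
  by case: ifP => [/andP[/eqP -> /eqP ->]//|_]; exact: filterT.
by move=> /(_ i j); rewrite !eqxx.
Qed.

Fact mulmx_cV_continuous (X : topologicalType) (f : X -> 'M[R]_n)
    (g : X -> 'cV[R]_n) :
  continuous f -> continuous g -> continuous (fun x => f x *m g x).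
Proof.
move=> cf cg; apply: cV_continuous => i.
rewrite (_ : (fun x => _) = (fun x => \sum_k f x i k * g x k 0)); last first.
  by apply/funext => x; rewrite mxE.
apply: (@continuous_big _ _ +%R) => [|k _ x]; first exact: add_continuous.
apply: cvgM.
  exact: (continuous_comp (cf x) (@entry_continuous _ _ i k (f x))).
exact: (continuous_comp (cg x) (@entry_continuous _ _ k 0 (g x))).
Qed.

Fact sd_pair_continuous (X : topologicalType) (f : X -> L) (g : X -> 'cV[R]_n) :
  continuous f -> continuous g -> continuous (fun x => (f x, g x) : H).
Proof. by move=> cf cg x; exact: (cvg_pair (cf x) (cg x)). Qed.

Fact sd_fst_continuous : continuous (fst : H -> L).
Proof. by move=> [x y]; exact: cvg_fst. Qed.
Fact sd_snd_continuous : continuous (snd : H -> 'cV[R]_n).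
Proof. by move=> [x y]; exact: cvg_snd. Qed.

Fact comp_continuous (X Y Z : topologicalType) (f : X -> Y) (g : Y -> Z) :
  continuous f -> continuous g -> continuous (g \o f).
Proof. by move=> cf cg x; apply: continuous_comp; [exact: cf|exact: cg]. Qed.

Fact cV_add_continuous (X : topologicalType) (f g : X -> 'cV[R]_n) :
  continuous f -> continuous g -> continuous (fun x => f x + g x).
Proof.
move=> cf cg; apply: cV_continuous => i x.
rewrite (_ : (fun x => _) = (fun x => f x i 0 + g x i 0)); last first.
  by apply/funext => y; rewrite mxE.
apply: cvgD.
  exact: (continuous_comp (cf x) (@entry_continuous _ _ i 0 (f x))).
exact: (continuous_comp (cg x) (@entry_continuous _ _ i 0 (g x))).
Qed.

Fact cV_opp_continuous (X : topologicalType) (f : X -> 'cV[R]_n) :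
  continuous f -> continuous (fun x => - f x).
Proof.
move=> cf; apply: cV_continuous => i x.
rewrite (_ : (fun x => _) = (fun x => - f x i 0)); last first.
  by apply/funext => y; rewrite mxE.
apply: cvgN; exact: (continuous_comp (cf x) (@entry_continuous _ _ i 0 (f x))).
Qed.

Fact sd_mul_continuous : continuous (fun xy : H * H => (xy.1 * xy.2)%g).
Proof.
have c1 : continuous (fst : H * H -> H) by move=> [x y]; exact: cvg_fst.
have c2 : continuous (snd : H * H -> H) by move=> [x y]; exact: cvg_snd.
apply: sd_pair_continuous.
  move=> xy; apply: (@continuous_comp _ _ _
    (fun xy : H * H => (xy.1.1, xy.2.1)) (fun ab : L * L => (ab.1 * ab.2)%g)).
    exact: (cvg_pair (comp_continuous c1 sd_fst_continuous (x := xy))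
                     (comp_continuous c2 sd_fst_continuous (x := xy))).
  exact: mulg_continuous.
apply: cV_add_continuous; first exact: (comp_continuous c1 sd_snd_continuous).
apply: mulmx_cV_continuous; last exact: (comp_continuous c2 sd_snd_continuous).
exact: (comp_continuous (comp_continuous c1 sd_fst_continuous)
                        (@fin_rep_continuous _ _ _ rho)).
Qed.

Fact sd_inv_continuous : continuous (fun x : H => (x^-1)%g).
Proof.
have cV := comp_continuous sd_fst_continuous (@invg_continuous L).
apply: sd_pair_continuous => //.
apply: cV_opp_continuous; apply: mulmx_cV_continuous.
  exact: (comp_continuous cV (@fin_rep_continuous _ _ _ rho)).
exact: sd_snd_continuous.
Qed.

HB.instance Definition _ :=
  isTopGroup.Build H sd_mul_continuous sd_inv_continuous.
End Semidirect.

Section Lattice.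
Local Open Scope quotient_scope.
Context {G : topGroupType} (S : subgroup G).

Definition coset_rel (x y : G) : bool := `[< subgroup_set S (x^-1 * y)%g >].

Fact coset_rel_refl : reflexive coset_rel.
Proof. by move=> x; apply/asboolP; rewrite mulVg; case: (subgroupP S). Qed.
Fact coset_rel_sym : symmetric coset_rel.
Proof.
have sym x y : coset_rel x y -> coset_rel y x.
  move=> /asboolP h; apply/asboolP; case: (subgroupP S) => _ _ /(_ _ h).
  by rewrite invgM invgK.
by move=> x y; apply/idP/idP; exact: sym.
Qed.
Fact coset_rel_trans : transitive coset_rel.
Proof.
move=> y x z /asboolP h1 /asboolP h2; apply/asboolP.
case: (subgroupP S) => _ /(_ _ _ h1 h2) + _.
by rewrite mulgA mulgK.
Qed.

Canonical coset_equiv :=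
  EquivRel coset_rel coset_rel_refl coset_rel_sym coset_rel_trans.

(* The space G/S of left cosets xS, with the quotient topology. *)
Definition coset_space : Type := quotient_topology {eq_quot coset_equiv}.

HB.instance Definition _ := Topological.on coset_space.
HB.instance Definition _ := Quotient.on coset_space.
HB.instance Definition _ :=
  isPointed.Build coset_space (\pi_coset_space (1%g : G)).

Definition coset_act (g : G) (q : coset_space) : coset_space :=
  \pi_coset_space (g * repr q)%g.

Definition coset_borel : Type :=
  g_sigma_algebraType (@open coset_space).

HB.instance Definition _ := Measurable.on coset_borel.

Definition discrete_subgroup : Prop :=
  exists2 U, open U & U `&` S = [set 1%g].

Definition finite_covolume (R : realType) : Prop :=
  exists mu : {measure set coset_borel -> \bar R},
    [/\ (0 < mu setT)%E, (mu setT < +oo)%E &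
        forall (g : G) (A : set coset_borel), measurable A ->
          mu ((coset_act g : coset_borel -> coset_borel) @^-1` A) = mu A].

Definition lattice (R : realType) : Prop :=
  discrete_subgroup /\ finite_covolume R.
End Lattice.

(* Main.v *)
Require Import Defs.
From HB Require Import structures.
From mathcomp Require Import all_boot all_order all_algebra sesquilinear.
From mathcomp Require Import all_classical all_reals all_analysis.
From mathcomp Require Import complex generic_quotient.

(* On H the map b(l, v) = v is a cocycle for the representation of H on R^n
   through L, tensored with the trivial one-dimensional unitary representation.
   If b is a coboundary on a subgroup G, with b(x) = x u - u, then G fixes the
   point -u of R^n under the affine action of H.  For G = H this is absurd since
   translations have no fixed point.  For a lattice G the orbit map of -u
   induces an H-equivariant continuous map H/G -> R^n, so a finite invariant
   measure on H/G would push forward to a finite translation-invariant measure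
   on R^n. *)

Import Order.TTheory GRing.Theory Num.Theory.
Import numFieldNormedType.Exports.
Local Open Scope classical_set_scope.
Local Open Scope ring_scope.

Section ComplexHilbert.
Context (R : realType).
Local Open Scope complex_scope.

Lemma normc_ge_Im (x : R[i]) : `|complex.Im x|%:C <= `|x|.
Proof.
rewrite normc_def lecR -sqrtr_sqr ler_sqrt ?addr_ge0 ?sqr_ge0//.
by rewrite lerDr sqr_ge0.
Qed.

(** Real and imaginary parts are additive and do not increase the norm, so they carry a Cauchy
    filter to Cauchy filters on [R], whose limits recombine. *)
Lemma complex_complete (F : set_system R[i]^o) :
  ProperFilter F -> cauchy F -> cvg F.
Proof.
move=> FF /(@cauchyP R[i] R[i]^o) Fc.
have cvg_part (p : R[i] -> R) : (forall x y, p (x - y) = p x - p y) ->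
    (forall x, `|p x|%:C <= `|x|) -> cvg (p @ F).
  move=> pB ple; apply: cauchy_cvg; apply/(@cauchyP R R) => e e0.
  have /Fc[z Fz] : (0 : R[i]) < e%:C by rewrite ltcR.
  exists (p z); apply: (@filterS _ F) Fz => x zx.
  change (`|p z - p x| < e); rewrite -pB -ltcR.
  exact: le_lt_trans (ple _) zx.
have /cvg_ex[/= a /cvgrPdist_lt Fa] : cvg (@complex.Re R @ F).
  by apply: cvg_part; [case=> ? ? []|exact: normc_ge_Re].
have /cvg_ex[/= b /cvgrPdist_lt Fb] : cvg (@complex.Im R @ F).
  by apply: cvg_part; [case=> ? ? []|exact: normc_ge_Im].
apply/cvg_ex; exists (a +i* b); apply/(@cvgrPdist_lt R[i] R[i]^o) => e e0.
(* In the order of [R[i]] a positive [e] is real; each part gets one half of it. *)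
have [r r0 ->] : exists2 r : R, 0 < r & e = r%:C + r%:C.
  case: e e0 => u v; rewrite ltcE /= => /andP[/eqP -> u0].
  by exists (u / 2); rewrite ?divr_gt0// -rmorphD -splitr.
near=> x.
have -> : a +i* b - x = (a - complex.Re x)%:C + 'i * (b - complex.Im x)%:C.
  by rewrite [LHS]complexE; case: {+}x.
rewrite (le_lt_trans (ler_normD _ _))// normrM !normc_def /= !expr0n !expr1n /=.
rewrite !addr0 add0r sqrtr1 mul1r !sqrtr_sqr ltrD// ltcR.
  by near: x; exact: Fa.
by near: x; exact: Fb.
Unshelve. all: by end_near. Qed.

(* An alias is needed: on [R[i]^o] itself, inference of the complete structure
   is captured by the instance on [R^o] for real [R]. *)
Definition complex_line : Type := R[i].

HB.instance Definition _ := NormedModule.copy complex_line R[i]^o.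
HB.instance Definition _ := isPointed.Build complex_line 0.
HB.instance Definition _ :=
  Uniform_isComplete.Build complex_line complex_complete.

Definition cinner (x y : complex_line) : R[i] := x * Num.conj y.

Fact cinner_bilinear : bilinear_for *%R (Num.conj \; *%R) cinner.
Proof.
split=> u a x y; rewrite /cinner/=; first by rewrite mulrDl -mulrA.
by rewrite rmorphD rmorphM mulrDr mulrCA.
Qed.

HB.instance Definition _ := bilinear_isBilinear.Build
  R[i] complex_line complex_line R[i] *%R (Num.conj \; *%R) cinner
  cinner_bilinear.

Fact cinner_hermitian x y : cinner x y = (-1) ^+ false * Num.conj (cinner y x).
Proof. by rewrite /cinner mul1r rmorphM /= conjCK mulrC. Qed.

HB.instance Definition _ := isHermitianSesquilinear.Build
  R[i] complex_line false Num.conj cinner cinner_hermitian.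

Fact cinner_gt0 (u : complex_line) : u != 0 -> 0 < cinner u u.
Proof. by move=> u0; rewrite /cinner mul_conjC_gt0. Qed.

HB.instance Definition _ :=
  isDotProduct.Build R[i] complex_line cinner cinner_gt0.

Fact cinner_normE (v : complex_line) : `|v| ^+ 2 = cinner v v.
Proof. exact: normCK. Qed.

HB.instance Definition _ :=
  hasInnerProduct.Build R[i] complex_line cinner_normE.
End ComplexHilbert.

Lemma real_complex_continuous (R : realType) :
  continuous (real_complex R : R -> complex_line R).
Proof.
move=> x; apply/cvgrPdist_lt => -[e ?] /[1!ltcE]/= /andP[/eqP -> e0].
have /cvgrPdist_lt/(_ e e0) : y @[y --> x] --> x by exact: cvg_id.
apply: filterS => y.
by rewrite -rmorphB normc_def /= expr0n addr0 sqrtr_sqr ltcR.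
Qed.

Definition trivial_rep (R : realType) (D : topGroupType) :
  unitary_rep D (complex_line R).
Proof.
refine (@UnitaryRep _ D _ (fun _ v => v) _ _ _ _ _) => // v.
exact: cst_continuous.
Defined.

Section TautologicalCocycle.
Context {R : realType} {L : topGroupType} {n : nat} {rho : fin_rep R L n}.
Context {D : topGroupType} {j : D -> semidirect rho}.
Context (jM : forall x y, j (x * y)%g = (j x * j y)%g) (jc : continuous j).

(** [j] will be the identity of [semidirect rho] or the inclusion of a subgroup. *)
Definition pullback_rep : fin_rep R D n.
Proof.
refine (@FinRep _ D n (fun x => rho (j x).1) _ _ _).
(* [j] is only assumed multiplicative; cancellation gives [j 1 = 1]. *)
- have : (j 1 * j 1 = j 1 * 1)%g by rewrite -jM !mulg1.
  by move=> /mulgI ->; exact: fin_rep1.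
- by move=> x y; rewrite jM fin_repM.
- exact: comp_continuous (comp_continuous jc (@sd_fst_continuous _ _ _ rho))
    (@fin_rep_continuous _ _ _ rho).
Defined.

(* Pushing the primitive of the cocycle down from C^n to R^n by taking real
   parts is legitimate because the matrices of [rho] are real. *)
Lemma FH_fixed_point : property_FH R D ->
  exists u : 'cV[R]_n, forall x, (j x).2 = rho (j x).1 *m u - u.
Proof.
case=> /(_ n pullback_rep _ (trivial_rep R D)) FH _.
(* The translation part, embedded in C^n; its cocycle identity is the second component of the
   semidirect product law. *)
pose b (x : D) : 'cV[complex_line R]_n := \col_i real_complex R ((j x).2 i 0).
have [|w bw] := FH b.
  split.
    move=> x A [P Pn sA]; rewrite nbhs_simpl /=.
    have : \forall y \near x, forall i, P i 0 (b y i 0).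
      apply: filter_forall => i.
      have := comp_continuous (comp_continuous (comp_continuous jc
        (@sd_snd_continuous _ _ _ rho)) (@entry_continuous R n 1 i 0))
        (real_complex_continuous R).
      move/(_ x (P i 0)); move: (Pn i 0); rewrite /b mxE /= => Pi /(_ Pi).
      by apply: (@filterS _ (nbhs x)) => y /=; rewrite mxE.
    by apply: filterS => y hy; apply: sA => i k; rewrite (ord1 k); exact: hy.
  move=> x y; apply/matrixP => i k; rewrite (ord1 k) !mxE jM /= !mxE.
  rewrite rmorphD rmorph_sum /=; congr (_ + _); apply: eq_bigr => l _.
  by rewrite mxE rmorphM.
exists (\col_i complex.Re (w i 0)) => x.
apply/matrixP => i k; rewrite (ord1 k) !mxE.
have := congr1 (fun A : 'cV[complex_line R]_n => complex.Re (A i 0)) (bw x).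
rewrite !mxE /= raddfB raddf_sum /= => ->; congr (_ - _).
apply: eq_bigr => l _; rewrite mxE.
by case: (w l 0) => a c /=; rewrite mul0r subr0.
Qed.
End TautologicalCocycle.

Section Translation.
Context {R : realType} {d : measure_display} {T : measurableType d}.
Context (mu : {measure set T -> \bar R}).

(** The sets where [f x < k] increase to the whole space, so continuity from below turns their
    constant measure into the total one. *)
Lemma translation_invariant_full (f : T -> R) :
    (forall r, measurable [set x | f x < r]) ->
    (forall r, mu [set x | f x < r] = mu [set x | f x < 0]) ->
  mu [set x | f x < 0] = mu setT.
Proof.
move=> mf muf; have fT : \bigcup_k [set x | f x < k%:R] = setT.
  rewrite -subTset => x _; exists (Num.truncn `|f x|).+1 => //=.
  exact: le_lt_trans (ler_norm _) (truncnS_gt _).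
have /cvg_lim <- // : mu [set x | f x < k%:R] @[k --> \oo] --> mu setT.
  rewrite -fT; apply: nondecreasing_cvg_mu => //.
    by rewrite fT.
  move=> k m km; apply/subsetPset => x /= /lt_le_trans; apply.
  by rewrite ler_nat.
rewrite (_ : (fun k => _) = cst (mu [set x | f x < 0])) ?lim_cst//.
exact/funext.
Qed.

(** The disjoint sets [f < 0] and [f > 0] both have full measure, so the finite total mass m
    satisfies m + m <= m. *)
Lemma translation_invariant_null (f : T -> R) :
    (forall r, measurable [set x | f x < r]) ->
    (forall r, measurable [set x | - f x < r]) ->
    (forall r, mu [set x | f x < r] = mu [set x | f x < 0]) ->
    (forall r, mu [set x | - f x < r] = mu [set x | - f x < 0]) ->
  (mu setT < +oo)%E -> mu setT = 0%E.
Proof.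
move=> mf mNf muf muNf muT.
have : (mu setT + mu setT <= mu setT)%E.
  rewrite -[in X in (X + _)%E](translation_invariant_full _ mf muf).
  rewrite -[in X in (_ + X)%E](translation_invariant_full _ mNf muNf).
  rewrite -measureU//.
    by apply: le_measure; rewrite ?inE//; exact: measurableU.
  rewrite -subset0 => x [/=]; rewrite oppr_lt0 => /lt_trans/[apply].
  by rewrite ltxx.
have muTf : mu setT \is a fin_num by rewrite ge0_fin_numE.
rewrite -[leRHS]adde0 leeD2lE// => muT0.
by apply/eqP; rewrite eq_le muT0 measure_ge0.
Qed.
End Translation.

Section FixedPoint.
Local Open Scope quotient_scope.
Context {R : realType} {L : topGroupType} {n : nat} {rho : fin_rep R L n.+1}.

Lemma fixed_point_infinite_covolume (G : subgroup (semidirect rho))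
    (u : 'cV[R]_n.+1) :
  (forall x, subgroup_set G x -> x.2 = rho x.1 *m u - u) ->
  ~ finite_covolume G R.
Proof.
move=> Gu [mu [mu0 muT muI]].
(* First coordinate of the image of [-u] under the affine action of [x]. *)
pose F (x : semidirect rho) : R := (x.2 - rho x.1 *m u) 0 0.
have Fc : continuous F.
  apply: comp_continuous (@entry_continuous _ _ _ 0 0).
  apply: cV_add_continuous; first exact: sd_snd_continuous.
  apply: cV_opp_continuous; apply: mulmx_cV_continuous;
    last exact: cst_continuous.
  exact: comp_continuous (@sd_fst_continuous _ _ _ rho)
    (@fin_rep_continuous _ _ _ rho).
(* Here y = x g with g in [G]; since g fixes [-u], both x and y send [-u] to the same point. *)
have FG x y : coset_rel G x y -> F x = F y.
  move=> /asboolP /Gu; rewrite /= => e; rewrite -[y](mulVKg x) /F /= fin_repM.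
  by rewrite -mulmxA -addrA -mulmxBr e addrAC subrr add0r mulmxN.
pose f : coset_space G -> R := F \o repr.
have fpi x : f (\pi_(coset_space G) x) = F x.
  by apply/esym/FG; apply/eqquotP; exact: esym (reprK (\pi_(coset_space G) x)).
have fc : continuous f.
  apply: repr_comp_continuous Fc _ => x y /eqP/eqquotP xy.
  by apply/eqP/FG.
pose trans (t : R) : semidirect rho := (1%g, const_mx t).
have f_trans t q : f (coset_act (trans t) q) = f q + t.
  rewrite /coset_act fpi /f /F /= mul1g fin_rep1 mul1mx !mxE.
  by rewrite -addrA addrC.
have ms (h : coset_space G -> R) : continuous h ->
    forall r, measurable ([set x | h x < r] : set (coset_borel G)).
  move=> hc r; apply: sub_sigma_algebra.
  exact: open_comp (in1W hc) (@open_lt _ r).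
have Nfc : continuous (fun q => - f q)
  by exact: comp_continuous fc (@opp_continuous R).
(* Translation by [s * r] pulls the set [h < r] back to [h < 0]; the sign [s] (1 or -1) lets this
   serve both [f] and [-f]. *)
have shift (h : coset_space G -> R) (s : R) : continuous h ->
    (forall t q, h (coset_act (trans (s * t)) q) = h q + t) ->
    forall r, mu [set x | h x < r] = mu [set x | h x < 0].
  move=> hc hs r.
  rewrite -(muI (trans (s * r)) [set x | h x < r]) //; last exact: ms.
  by congr (mu _); apply/funext => q /=; rewrite hs gtrDr.
move: mu0; rewrite (translation_invariant_null mu f) ?ltxx //.
- exact: ms.
- exact: ms.
- by apply: (shift f 1) => // t q; rewrite mul1r.
- by apply: (shift _ (-1)) => // t q; rewrite f_trans mulN1r opprB addrC.
Qed.
End FixedPoint.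

Theorem proposition2p1 (R : realType) (n : nat) (hn : (1 <= n)%N)
    (L : topGroupType) (rho : fin_rep R L n)
    (hL : semisimple_lie_group R L)
    (hcpt : no_compact_factors L)
    (hT : kazhdan_T R L)
    (hinv : forall v : 'cV[R]_n, (forall l : L, rho l *m v = v) -> v = 0) :
  ~ property_FH R (semidirect rho) /\
  (forall G : subgroup (semidirect rho),
     lattice G R -> ~ property_FH R (subgroup_type G)).
Proof.
case: n hn rho hinv => // n _ rho _; split=> [|G [_ Gcov]] FH.
  have [u uP] := @FH_fixed_point R L _ rho _ id (fun _ _ => erefl)
    (fun _ => cvg_id) FH.
  (* A pure translation has trivial linear part, so its translation vector would be u - u = 0, while
     its entries are 1. *)
  have /(congr1 (fun A : 'cV[R]_n.+1 => A 0 0)) := uP (1%g, const_mx 1).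
  by rewrite /= fin_rep1 mul1mx subrr !mxE => /eqP; rewrite oner_eq0.
have [u uP] := @FH_fixed_point R L _ rho _
  (fun x : subgroup_type G => val x) (fun _ _ => erefl)
  (@subg_val_continuous _ G) FH.
apply: (fixed_point_infinite_covolume G u _ Gcov) => x Gx.
exact: (uP (SigSub (mem_set Gx))).
Qed.
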